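(* Let $1/3\le p<1$. Define a sequence $(\mu_n)_{n\ge1}$ by $$\mu_1=0,\qquad \mu_{n+1}=\left(n^{-p}+\mu_n^{1-p}\right)^{1/(1-p)}-\left(\frac1p-1\right)^{p/(p-1)},\quad n\ge1.$$ If there exist an integer $n_0\ge1$ and a constant $c$ such that $$\mu_{n_0}\ge\left(\frac1p-1\right)^{1/(p-1)}(n_0+c),\qquad c>-\frac1{2p},$$ $$\left(\frac1p-1\right)\cdot\frac1{n_0}+\left(1+c\cdot\frac1{n_0}\right)^{1-p}-\left(1+\left(c+\frac1p\right)\cdot\frac1{n_0}\right)^{1-p}\ge0,$$ then the inequality $$\sum_{n=1}^\infty\left(\frac1n\sum_{k=n}^\infty x_k\right)^p\ge C_p\sum_{n=1}^\infty x_n^p$$ holds for all sequences $(x_n)_{n\ge1}$ of positive real numbers with $C_p=(p/(1-p))^p$, and this constant is best possible.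
   Context: Standing assumption: all infinite sums appearing are assumed to converge. ''Best possible'' means that the inequality fails for some admissible sequence if $C_p$ is replaced by any larger constant. Real powers are taken of nonnegative bases only: the recursion is understood to be defined as long as $\mu_n\ge0$, and the hypotheses presuppose that $\mu_1,\dots,\mu_{n_0}$ are all defined and that $1+c/n_0\ge0$. *)

(* Defs.v *)
From HB Require Import structures.
From mathcomp Require Import all_boot all_order all_algebra.
From mathcomp Require Import all_classical all_reals all_analysis.
Set Implicit Arguments.
Unset Strict Implicit.
Unset Printing Implicit Defensive.
Import Order.TTheory GRing.Theory Num.Theory.
Import numFieldNormedType.Exports.
Local Open Scope classical_set_scope.
Local Open Scope ring_scope.

(* Sequences are indexed by n >= 1: values at index 0 are junk and are never
   used.  Real powers are [powR], for which [0 `^ a = 0] when [a != 0]; its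
   value on negative bases is junk. *)

Definition psum (R : realType) (m : nat) (u : nat -> R) : nat -> R :=
  fun N => \sum_(m <= k < N) u k.

Definition summable_from (R : realType) (m : nat) (u : nat -> R) : Prop :=
  cvgn (psum m u).

Definition sum_from (R : realType) (m : nat) (u : nat -> R) : R :=
  limn (psum m u).

Fixpoint mu (R : realType) (p : R) (n : nat) {struct n} : R :=
  match n with
  | 0%N | 1%N => 0
  | m.+1 =>
      (m%:R `^ (- p) + mu p m `^ (1 - p)) `^ (1 / (1 - p))
      - (1 / p - 1) `^ (p / (p - 1))
  end.

(* [mu p n] makes mathematical sense only if the earlier terms, which are
   raised to the power [1 - p] in the recursion, are nonnegative. *)
Definition mu_defined (R : realType) (p : R) (n : nat) : Prop :=
  forall m : nat, (1 <= m < n)%N -> 0 <= mu p m.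

Definition tail_mean_pow (R : realType) (p : R) (x : nat -> R) : nat -> R :=
  fun n => (1 / n%:R * sum_from n x) `^ p.

Definition admissible (R : realType) (p : R) (x : nat -> R) : Prop :=
  [/\ forall n : nat, (1 <= n)%N -> 0 < x n,
      forall n : nat, (1 <= n)%N -> summable_from n x,
      summable_from 1 (tail_mean_pow p x) &
      summable_from 1 (fun n => x n `^ p)].

Definition copson_ineq (R : realType) (p C : R) (x : nat -> R) : Prop :=
  sum_from 1 (tail_mean_pow p x) >= C * sum_from 1 (fun n => x n `^ p).

(* Main.v *)
Require Import Defs.
From HB Require Import structures.
From mathcomp Require Import all_boot all_order all_algebra.
From mathcomp Require Import all_classical all_reals all_analysis.
From mathcomp Require Import ring lra.
Import Order.TTheory GRing.Theory Num.Theory.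
Import numFieldNormedType.Exports.
Local Open Scope classical_set_scope.
Local Open Scope ring_scope.

(** Write S_n for the tail sum of x from n, so that x_n = S_n - S_(n+1), and
    C for the constant (p / (1 - p))^p.  Hoelder's inequality for two terms,
    with exponents 1/p and 1/(1-p), gives
      C x_n^p + nu' S_(n+1)^p <= (C^(1/(1-p)) + nu'^(1/(1-p)))^(1-p) S_n^p.
    With nu_n = mu_n^(1-p), the recursion defining mu says exactly that the
    factor on the right is n^(-p) + nu_n when nu' = nu_(n+1).  Hence
      C x_n^p <= n^(-p) S_n^p + nu_n S_n^p - nu_(n+1) S_(n+1)^p
    ([copson_step]); summed over n the last two terms telescope, and nu_1 = 0
    while nu_N S_N^p >= 0, which is the inequality ([copson_of_mu_ge0]).  All
    of this only requires that every mu_n is nonnegative.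

    Nonnegativity comes from the linear bound
    mu_n >= (1/p - 1)^(1/(p-1)) (n + c) for n >= n0.  It passes from n to
    n + 1 as soon as the last hypothesis of the theorem holds with n in place
    of n0 ([mu_lower_bound_step]), so the point is to carry that hypothesis
    from n0 to every larger n.  Put N(h) = 1 + (1-p) h - (1+h)^(1-p), the gap
    between t^(1-p) and its tangent at t = 1.  The hypothesis at n reads
    N(c/n) <= N((c + 1/p)/n).  Passing from n0 to n multiplies both arguments
    by l = n0/n < 1.  Compared with the quadratic l^2 N(h), the value N(l h)
    is larger for h >= 0 and smaller for h <= 0 ([tangent_gap_scale_mono]);
    therefore, when c < 0 <= c + 1/p, the inequality between the two values is
    preserved ([tangent_gap_ray_le]).  When c >= 0 it holds anyway, since N is
    nondecreasing on the nonnegative half-line.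

    For sharpness take S_n = n^(-s) with s slightly larger than (1-p)/p.  Then
    the left-hand series is Z, the sum of n^(-1-d), with d = s p - (1-p) small,
    and x_n >= s (n+1)^(-s-1) makes the sum of x_n^p at least s^p (Z - 1),
    where s^p >= 1/C.  As d tends to 0 the ratio Z / (Z - 1) tends to 1, because
    Z >= 1/d ([copson_fails_above]). *)

(** * Inequalities for real powers *)

Lemma geom_le_arith_mean (R : realType) (q a b : R) :
  0 < q < 1 -> 0 <= a -> 0 <= b ->
  a `^ q * b `^ (1 - q) <= q * a + (1 - q) * b.
Proof.
move=> /andP[q0 q1] a0 b0.
have q1' : 0 < 1 - q by rewrite subr_gt0.
have := @conjugate_powR R (a `^ q) (b `^ (1 - q)) q^-1 (1 - q)^-1.
rewrite !powR_ge0 !invr_gt0 !invrK => /(_ isT isT q0 q1').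
rewrite -!powRrM !divff ?gt_eqF// !powRr1//.
by rewrite (mulrC a) (mulrC b); apply; rewrite addrC subrK.
Qed.

(** The convex function t^(-s) lies above its tangents.  After scaling by a
    this is e^y >= 1 + y at y = - s ln r, combined with ln r <= r - 1. *)
Lemma powRN_tangent (R : realType) (s a b : R) :
  0 < s -> 0 < a -> 0 < b ->
  a `^ (- s) - s * a `^ (- s - 1) * (b - a) <= b `^ (- s).
Proof.
move=> s0 a0 b0; set r := b / a.
have r0 : 0 < r by rewrite divr_gt0.
have -> : b = a * r by rewrite /r mulrCA divff ?mulr1// gt_eqF.
have rs : 1 - s * (r - 1) <= r `^ (- s).
  rewrite /powR gt_eqF//; apply: le_trans (expR_ge1Dx _).
  rewrite lerD2l mulNr lerN2 ler_pM2l//.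
  have -> : ln r = ln (1 + (r - 1)) by congr ln; ring.
  by apply: le_ln1Dx; lra.
rewrite (powRM _ (ltW a0) (ltW r0)).
have -> : a `^ (- s) = a `^ (- s - 1) * a.
  rewrite -[X in _ * X]powRr1 ?ltW// -powRD ?subrK//.
  by rewrite (gt_eqF a0) implybT.
apply: le_trans (ler_wpM2l (mulr_ge0 (powR_ge0 a (- s - 1)) (ltW a0)) rs).
by rewrite le_eqVlt; apply/orP; left; apply/eqP; ring.
Qed.

(** Convexity of t^(-p) on the chord from 1 to 1 + h, obtained by inserting
    (1 + h)^(- l p) between the two sides: each of the two comparisons is an
    instance of the inequality between weighted means. *)
Lemma powRN_le_chord (R : realType) (p l h : R) :
  0 < p -> 0 < l < 1 -> -1 < h ->
  (1 + l * h) `^ (- p) <= 1 - l + l * (1 + h) `^ (- p).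
Proof.
move=> p0 hl h1; have /andP[l0 l1] := hl.
have h0 : 0 < 1 + h by lra.
have lh0 : 0 < 1 + l * h by nra.
apply: (@le_trans _ _ ((1 + h) `^ (l * - p))); last first.
  have := geom_le_arith_mean _ _ _ _ hl (powR_ge0 (1 + h) (- p)) ler01.
  by rewrite powR1 !mulr1 -powRrM [- p * l]mulrC [X in _ <= X -> _]addrC.
rewrite powRrM !powRN lef_pV2 ?posrE ?powR_gt0//.
apply: (ge0_ler_powR (ltW p0)); rewrite ?nnegrE ?powR_ge0 ?(ltW lh0)//.
have := geom_le_arith_mean _ _ _ _ hl (ltW h0) ler01.
by rewrite powR1 !mulr1 => amgm; apply: le_trans amgm _; lra.
Qed.

(** * The tangent gap of a concave power *)

Definition tangent_gap (R : realType) (p h : R) : R :=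
  1 + (1 - p) * h - (1 + h) `^ (1 - p).

Lemma is_derive_tangent_gap (R : realType) (p h : R) : -1 < h ->
  is_derive h 1 (tangent_gap R p) ((1 - p) * (1 - (1 + h) `^ (- p))).
Proof.
move=> h1; have h0 : 0 < 1 + h by lra.
have d1 : is_derive h 1 (cst 1 + id : R -> R) 1.
  by rewrite -[X in is_derive _ _ _ X]add0r; exact: is_deriveD.
have d2 : is_derive h 1 ((fun x : R => x `^ (1 - p)) \o (cst 1 + id))
    ((1 - p) * (1 + h) `^ (- p)).
  have -> : (1 - p) * (1 + h) `^ (- p) = ((1 - p) * (1 + h) `^ (1 - p - 1)) * 1.
    by rewrite mulr1 addrAC subrr add0r.
  by apply: is_derive1_comp; exact: is_derive1_powR.
have d3 : is_derive h 1 ((1 - p) \*: (id : R -> R)) ((1 - p) *: 1).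
  exact: is_deriveZ.
have := is_deriveB (is_deriveD (@is_derive_cst R R R 1 h 1) d3) d2.
by rewrite add0r mulrBr.
Qed.

Lemma tangent_gap0 (R : realType) (p : R) : tangent_gap R p 0 = 0.
Proof. by rewrite /tangent_gap mulr0 !addr0 powR1 subrr. Qed.

(** The derivative of N(l h) - l^2 N(h) is l (1-p) times the amount by which
    the chord of t^(-p) exceeds its graph, hence nonnegative.  As the
    function vanishes at h = 0, this decides its sign on both sides of 0. *)
Lemma tangent_gap_scale_mono (R : realType) (p l h k : R) :
  0 < p < 1 -> 0 < l < 1 -> -1 < h -> h <= k ->
  tangent_gap R p (l * h) - l ^+ 2 * tangent_gap R p h <=
  tangent_gap R p (l * k) - l ^+ 2 * tangent_gap R p k.
Proof.
move=> /andP[p0 p1] hl h1 hk; have /andP[l0 l1] := hl.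
pose D : R -> R :=
  (tangent_gap R p \o (l \*: id)) - (l ^+ 2 \*: tangent_gap R p).
have dD (x : R) : -1 < x -> is_derive x 1 D
   (l * (1 - p) * (1 - l + l * (1 + x) `^ (- p) - (1 + l * x) `^ (- p))).
  move=> x1; have d3 : is_derive x 1 (l \*: (id : R -> R)) (l *: 1).
    exact: is_deriveZ.
  have lx1 : -1 < l * x by nra.
  have d4 := is_derive1_comp (is_derive_tangent_gap _ p (l * x) lx1) d3.
  have := is_deriveB d4 (is_deriveZ (l ^+ 2) (is_derive_tangent_gap _ p x x1)).
  move=> dd; rewrite /D; apply: (is_derive_eq dd).
  rewrite /GRing.scale /=; ring.
have Dc : {within `[h, k], continuous D}.
  apply: derivable_within_continuous => x; rewrite in_itv /= => /andP[hx _].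
  by have [] := dD x (lt_le_trans h1 hx).
suff : D h <= D k by rewrite /D !fctE.
have mem (x : R) : x \in `]h, k[%R -> -1 < x.
  by rewrite in_itv /= => /andP[hx _]; exact: lt_trans h1 hx.
refine (@ger0_derive1_ndecr R D h k _ _ Dc h k (lexx h) hk (lexx k)).
  by move=> x /mem x1; have [] := dD x x1.
move=> x /mem x1; have dx := dD x x1.
rewrite derive1E derive_val mulr_ge0//; first nra.
by rewrite subr_ge0 powRN_le_chord.
Qed.

Lemma tangent_gap_scale_ge (R : realType) (p l h : R) :
  0 < p < 1 -> 0 < l < 1 -> 0 <= h ->
  l ^+ 2 * tangent_gap R p h <= tangent_gap R p (l * h).
Proof.
move=> hp hl h0.
have := tangent_gap_scale_mono _ p l 0 h hp hl _ h0.
by rewrite mulr0 tangent_gap0 mulr0 subrr subr_ge0; apply; lra.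
Qed.

(** At h = -1 the power (1 + h)^(-p) in the derivative degenerates; there the
    claim reduces to Bernoulli's inequality 1 + p l <= (1 - l)^(-p). *)
Lemma tangent_gap_scale_le (R : realType) (p l h : R) :
  0 < p < 1 -> 0 < l < 1 -> -1 <= h <= 0 ->
  tangent_gap R p (l * h) <= l ^+ 2 * tangent_gap R p h.
Proof.
move=> hp hl /andP[]; rewrite le_eqVlt => /predU1P[<- _|h1 h0]; last first.
  have := tangent_gap_scale_mono _ p l h 0 hp hl h1 h0.
  by rewrite mulr0 tangent_gap0 mulr0 subrr subr_le0.
have /andP[p0 p1] := hp; have /andP[l0 l1] := hl.
have q0 : 0 < 1 - p by rewrite subr_gt0.
rewrite /tangent_gap subrr powR0 ?subr_eq0 ?gt_eqF//.
have ml : 0 < 1 - l by lra.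
have -> : (1 + l * -1) `^ (1 - p) = (1 - l) * (1 - l) `^ (- p).
  by rewrite mulrN1 -(mulr_powRB1 (ltW ml) q0) addrAC subrr add0r.
have := powRN_tangent R p 1 (1 - l) p0 ltr01 ml.
rewrite !powR1; nra.
Qed.

(** The slope of t^(1-p) at t >= 1 is at most its slope 1 - p at 1. *)
Lemma tangent_gap_le (R : realType) (p h k : R) :
  0 < p < 1 -> 0 <= h -> h <= k -> tangent_gap R p h <= tangent_gap R p k.
Proof.
move=> hp h0 hk; have /andP[p0 p1] := hp.
have hq : 0 < 1 - p < 1 by lra.
have h1 : 0 < 1 + h by lra.
have k1 : 0 <= 1 + k by lra.
have := geom_le_arith_mean _ _ _ _ hq k1 (ltW h1).
rewrite subKr /tangent_gap => amgm.
have hp1 : 1 <= (1 + h) `^ p.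
  by rewrite -[leLHS](powRr0 (1 + h)) ler_powR ?(ltW p0)//; lra.
have hE : (1 + h) `^ (1 - p) * (1 + h) `^ p = 1 + h.
  by rewrite -powRD ?subrK ?(powRr1 (ltW h1))// (gt_eqF h1) implybT.
have slope : ((1 + k) `^ (1 - p) - (1 + h) `^ (1 - p)) * (1 + h) `^ p <=
    (1 - p) * (k - h).
  by rewrite mulrBl hE; move: amgm; lra.
suff : (1 + k) `^ (1 - p) - (1 + h) `^ (1 - p) <= (1 - p) * (k - h) by lra.
have [V0|V0] := leP ((1 + k) `^ (1 - p) - (1 + h) `^ (1 - p)) 0.
  by apply: le_trans V0 _; rewrite mulr_ge0// ?subr_ge0// ltW.
by apply: le_trans slope; rewrite ler_peMr// ltW.
Qed.

(** Moving both arguments towards 0 keeps the order of the gaps: a negative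
    argument makes the gap shrink at least by the factor l^2, a positive one
    at most by that factor.  Two nonnegative arguments are compared by
    [tangent_gap_le]. *)
Lemma tangent_gap_ray_le (R : realType) (p a b l : R) :
  0 < p < 1 -> 0 < l < 1 -> -1 <= a -> a <= b -> 0 <= b ->
  tangent_gap R p a <= tangent_gap R p b ->
  tangent_gap R p (l * a) <= tangent_gap R p (l * b).
Proof.
move=> hp hl a1 ab b0 gab; have /andP[l0 l1] := hl.
have [a0|a0] := leP 0 a.
  by apply: tangent_gap_le => //; [rewrite mulr_ge0// ltW | rewrite ler_pM2l].
apply: (le_trans (tangent_gap_scale_le _ _ _ _ hp hl _)).
  by rewrite a1 ltW.
apply: le_trans (tangent_gap_scale_ge _ _ _ _ hp hl b0).
by rewrite ler_wpM2l ?sqr_ge0.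
Qed.

(** * Linear growth of the sequence mu *)

Lemma muS (R : realType) (p : R) (n : nat) : (1 <= n)%N ->
  mu p n.+1 = (n%:R `^ (- p) + mu p n `^ (1 - p)) `^ (1 / (1 - p))
             - (1 / p - 1) `^ (p / (p - 1)).
Proof. by case: n. Qed.

(** With d = 1/p - 1 and a = d^(1/(p-1)) one has a^(1-p) = 1/d, and the
    constant subtracted in the recursion is a d.  So the claim at n + 1 is
    that n^(-p) + mu_n^(1-p) is at least (a (n + c + 1/p))^(1-p), and after
    division by n^(1-p) / d this is the hypothesis on the gaps. *)
Lemma mu_lower_bound_step (R : realType) (p c : R) (n : nat) :
  0 < p < 1 -> (1 <= n)%N -> 0 <= n%:R + c -> 0 <= n%:R + (c + 1 / p) ->
  tangent_gap R p (c / n%:R) <= tangent_gap R p ((c + 1 / p) / n%:R) ->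
  (1 / p - 1) `^ (1 / (p - 1)) * (n%:R + c) <= mu p n ->
  (1 / p - 1) `^ (1 / (p - 1)) * (n.+1%:R + c) <= mu p n.+1.
Proof.
move=> /andP[p0 p1] n1 nc ncp gap hmu; rewrite muS//.
have pne : p != 0 by rewrite gt_eqF.
have pne1 : p - 1 != 0 by rewrite subr_eq0 lt_eqF.
have q0 : 0 < 1 - p by rewrite subr_gt0.
have n0 : 0 < n%:R :> R by rewrite ltr0n.
set d := 1 / p - 1; have d0 : 0 < d by rewrite subr_gt0 mul1r invf_gt1.
rewrite -/d in hmu; set a := d `^ (1 / (p - 1)) in hmu *.
have a0 : 0 < a by rewrite powR_gt0.
have aq : a `^ (1 - p) = d^-1.
  by rewrite /a -powRrM -(powR_inv1 (ltW d0)); congr (_ `^ _); field.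
have ap : d `^ (p / (p - 1)) = a * d.
  transitivity (a * d `^ 1); last by rewrite (powRr1 (ltW d0)).
  by rewrite /a -powRD ?(gt_eqF d0) ?implybT//; congr (_ `^ _); field.
have scale b : 0 <= n%:R + b ->
    (a * (n%:R + b)) `^ (1 - p) =
    d^-1 * n%:R `^ (1 - p) * (1 + b / n%:R) `^ (1 - p).
  move=> nb.
  have -> : n%:R + b = n%:R * (1 + b / n%:R) by field; rewrite gt_eqF.
  rewrite powRM ?(ltW a0)//; last first.
    by have -> : n%:R * (1 + b / n%:R) = n%:R + b by field; rewrite gt_eqF.
  rewrite powRM ?(ltW n0) ?aq ?mulrA//.
  have -> : 1 + b / n%:R = (n%:R + b) / n%:R by field; rewrite gt_eqF.
  by rewrite divr_ge0 ?(ltW n0).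
have main : (a * (n%:R + (c + 1 / p))) `^ (1 - p) <=
    n%:R `^ (- p) + mu p n `^ (1 - p).
  have mono : (a * (n%:R + c)) `^ (1 - p) <= mu p n `^ (1 - p).
    apply: ge0_ler_powR => //; rewrite ?nnegrE ?(ltW q0)//.
      by rewrite mulr_ge0// ltW.
    by apply: le_trans hmu; rewrite mulr_ge0// ltW.
  rewrite -(lerD2l (n%:R `^ (- p))) in mono; apply: le_trans mono.
  rewrite !scale//.
  have -> : n%:R `^ (- p) = d^-1 * n%:R `^ (1 - p) * (d / n%:R).
    have -> : n%:R `^ (1 - p) = n%:R * n%:R `^ (- p) :> R.
      by rewrite -(mulr_powRB1 (ltW n0) q0) addrAC subrr add0r.
    by field; rewrite !gt_eqF.
  rewrite -mulrDr ler_wpM2l ?mulr_ge0 ?invr_ge0 ?powR_ge0 ?(ltW d0)//.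
  move: gap; rewrite /tangent_gap.
  have -> : (c + 1 / p) / n%:R = c / n%:R + (d + 1) / n%:R.
    by rewrite /d subrK mulrDl.
  have -> : (1 - p) * (c / n%:R + (d + 1) / n%:R) =
      (1 - p) * (c / n%:R) + d / n%:R.
    by rewrite mulrDr /d; congr (_ + _); field; rewrite pne gt_eqF.
  lra.
have acp0 : 0 <= a * (n%:R + (c + 1 / p)) by rewrite mulr_ge0// ltW.
have : a * (n%:R + (c + 1 / p)) <=
    (n%:R `^ (- p) + mu p n `^ (1 - p)) `^ (1 / (1 - p)).
  have root0 : 0 <= (1 - p)^-1 by rewrite invr_ge0 ltW.
  have := ge0_ler_powR root0 _ _ main.
  rewrite -powRrM (divff (_ : 1 - p != 0)) ?gt_eqF//.
  rewrite (powRr1 acp0) [1 / (1 - p)]mul1r.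
  by apply; rewrite nnegrE ?addr_ge0 ?powR_ge0.
rewrite ap -natr1 /d; lra.
Qed.

(** The lower bound on c makes c + 1/p positive, which puts the larger
    argument of the gap on the side of 0 where the gap shrinks slowly. *)
Lemma mu_ge0 (R : realType) (p c : R) (n0 : nat) :
  0 < p < 1 -> (1 <= n0)%N -> mu_defined p n0 ->
  0 <= 1 + c / n0%:R -> - (1 / (2 * p)) < c ->
  (1 / p - 1) `^ (1 / (p - 1)) * (n0%:R + c) <= mu p n0 ->
  tangent_gap R p (c / n0%:R) <= tangent_gap R p ((c + 1 / p) / n0%:R) ->
  forall n, (1 <= n)%N -> 0 <= mu p n.
Proof.
move=> hp n01 mudef c1 hc hmu gap.
have /andP[p0 p1] := hp.
have n00 : 0 < n0%:R :> R by rewrite ltr0n.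
have ip0 : 0 < 1 / p by rewrite divr_gt0.
have cp0 : 0 < c + 1 / p.
  have e : 1 / (2 * p) = (1 / p) / 2 by field; rewrite gt_eqF.
  by move: hc; rewrite e; lra.
have nc0 : 0 <= n0%:R + c.
  have -> : n0%:R + c = n0%:R * (1 + c / n0%:R) by field; rewrite gt_eqF.
  by rewrite mulr_ge0// ltW.
have nc n : (n0 <= n)%N -> 0 <= n%:R + c.
  by move=> nn; apply: (le_trans nc0); rewrite lerD2r ler_nat.
have bound n : (n0 <= n)%N ->
    (1 / p - 1) `^ (1 / (p - 1)) * (n%:R + c) <= mu p n.
  elim: n => [|n IH]; first by rewrite leqn0 => /eqP n0E; rewrite n0E in n01.
  rewrite leq_eqVlt => /predU1P[<-//|]; rewrite ltnS => nn.
  have n1 := leq_trans n01 nn.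
  have nR : 0 < n%:R :> R by rewrite ltr0n.
  apply: mu_lower_bound_step => //; [exact: nc| |  |exact: IH].
    by have := nc n nn; lra.
  move: nn; rewrite leq_eqVlt => /predU1P[<-//|nn].
  have l01 : 0 < (n0%:R : R) / n%:R < 1.
    by rewrite divr_gt0//= ltr_pdivrMr// mul1r ltr_nat.
  have resc (b : R) : b / n%:R = n0%:R / n%:R * (b / n0%:R).
    by field; rewrite !gt_eqF.
  rewrite (resc c) (resc (c + 1 / p)); apply: tangent_gap_ray_le => //.
  - by lra.
  - by rewrite ler_pM2r ?invr_gt0//; lra.
  - by rewrite divr_ge0 ?ltW.
move=> n n1; have [nn|nn] := ltnP n n0; first by apply: mudef; rewrite n1.
by apply: le_trans (bound n nn); rewrite mulr_ge0 ?powR_ge0 ?nc.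
Qed.

(** * Series from a given index *)

Lemma psum_recr (R : realType) (x : nat -> R) (m n : nat) :
  (m <= n)%N -> psum m x n.+1 = psum m x n + x n.
Proof. by move=> mn; rewrite /psum big_nat_recr. Qed.

Lemma psumZ (R : realType) (m : nat) (c : R) (u : nat -> R) (n : nat) :
  psum m (fun k => c * u k) n = c * psum m u n.
Proof. by rewrite /psum mulr_sumr. Qed.

Lemma psumS (R : realType) (m : nat) (u : nat -> R) (n : nat) :
  psum m (fun k => u k.+1) n = psum m.+1 u n.+1.
Proof. by rewrite /psum big_add1. Qed.

Lemma psum_cvgZ (R : realType) (m : nat) (u : nat -> R) (c l : R) :
  psum m u @ \oo --> l -> psum m (fun k => c * u k) @ \oo --> c * l.
Proof.
move=> ul; rewrite (_ : psum _ _ = fun n => c * psum m u n).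
  by apply: cvgM => //; exact: cvg_cst.
by apply/funext => n; rewrite psumZ.
Qed.

Lemma summable_fromZ (R : realType) (m : nat) (c : R) (u : nat -> R) :
  summable_from m u -> summable_from m (fun n => c * u n).
Proof. by move=> su; apply/cvg_ex; eexists; exact: psum_cvgZ su. Qed.

Lemma sum_fromZ (R : realType) (m : nat) (c : R) (u : nat -> R) :
  summable_from m u -> sum_from m (fun n => c * u n) = c * sum_from m u.
Proof. by move=> su; apply/cvg_lim => //; exact: psum_cvgZ su. Qed.

Lemma psum_recl_cvg (R : realType) (x : nat -> R) (n : nat) :
  summable_from n.+1 x -> psum n x @ \oo --> x n + sum_from n.+1 x.
Proof.
move=> sx; apply: (@cvg_trans _ ((x n + psum n.+1 x N) @[N --> \oo])).
  apply: near_eq_cvg; near=> N; rewrite /psum [in RHS]big_ltn//.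
  by near: N; exact: nbhs_infty_gt.
by apply: cvgD => //; exact: cvg_cst.
Unshelve. all: by end_near. Qed.

Lemma sum_from_recl (R : realType) (x : nat -> R) (n : nat) :
  summable_from n.+1 x -> sum_from n x = x n + sum_from n.+1 x.
Proof. by move=> sx; apply/cvg_lim => //; exact: psum_recl_cvg. Qed.

Lemma psum_shift_cvg (R : realType) (m : nat) (u : nat -> R) :
  summable_from m (fun k => u k.+1) ->
  psum m.+1 u @ \oo --> sum_from m (fun k => u k.+1).
Proof.
move=> su; rewrite -(cvg_shiftS (psum m.+1 u)).
rewrite (_ : [sequence _]_n = psum m (fun k => u k.+1))//.
by apply/funext => n; rewrite psumS.
Qed.

Lemma sum_from_shift (R : realType) (m : nat) (u : nat -> R) :
  summable_from m (fun k => u k.+1) ->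
  sum_from m.+1 u = sum_from m (fun k => u k.+1).
Proof. by move=> su; apply/cvg_lim => //; exact: psum_shift_cvg. Qed.

Lemma sum_from_ge0 (R : realType) (x : nat -> R) (n : nat) :
  summable_from n x -> (forall k, (n <= k)%N -> 0 <= x k) ->
  0 <= sum_from n x.
Proof.
move=> sx x0; apply: limr_ge => //; near=> N.
by rewrite /psum big_nat_cond sumr_ge0// => k /andP[/andP[/x0]].
Unshelve. all: by end_near. Qed.

Lemma sum_from_le (R : realType) (m : nat) (u v : nat -> R) :
  (forall n, (m <= n)%N -> u n <= v n) ->
  summable_from m u -> summable_from m v -> sum_from m u <= sum_from m v.
Proof.
move=> uv su sv; apply: ler_lim => //; near=> N.
rewrite /psum big_nat_cond [leRHS]big_nat_cond.
by apply: ler_sum => k /andP[/andP[/uv]].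
Unshelve. all: by end_near. Qed.

Lemma summable_from_le (R : realType) (m : nat) (u v : nat -> R) :
  (forall n, (m <= n)%N -> 0 <= u n <= v n) ->
  summable_from m v -> summable_from m u.
Proof.
move=> uv sv; apply: nondecreasing_is_cvgn.
  apply/nondecreasing_seqP => n; rewrite /psum.
  have [mn|nm] := leqP m n; last by rewrite !big_geq// ltnW.
  by rewrite big_nat_recr//= lerDl; have /andP[] := uv n mn.
have [M [_ hM]] := cvg_seq_bounded sv.
exists (M + 1) => _ [n _ <-].
apply: le_trans (le_trans (ler_norm _) (hM (M + 1) _ n I)); last first.
  by rewrite ltrDl.
rewrite /psum big_nat_cond [leRHS]big_nat_cond.
apply: ler_sum => k /andP[/andP[mk _] _].
by have /andP[] := uv k mk.
Qed.

Lemma tail_mean_powE (R : realType) (p : R) (x : nat -> R) (n : nat) :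
  0 <= sum_from n x ->
  tail_mean_pow p x n = n%:R `^ (- p) * sum_from n x `^ p.
Proof.
move=> S0; rewrite /tail_mean_pow powRM ?mul1r ?invr_ge0 ?ler0n//.
by rewrite -(powR_inv1 (ler0n R n)) -powRrM mulN1r.
Qed.

(** * The inequality when mu is nonnegative *)

Lemma copson_constant_powR (R : realType) (p : R) : 0 < p < 1 ->
  ((1 / p - 1) `^ (p / (p - 1))) `^ (1 - p) = (p / (1 - p)) `^ p.
Proof.
move=> /andP[p0 p1].
have pne : p != 0 by rewrite gt_eqF.
have pne1 : p - 1 != 0 by rewrite subr_eq0 lt_eqF.
have pne1' : 1 - p != 0 by rewrite subr_eq0 gt_eqF.
have d0 : 0 < 1 / p - 1 by rewrite subr_gt0 mul1r invf_gt1.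
have -> : p / (1 - p) = (1 / p - 1)^-1.
  by rewrite -invf_div; congr (_^-1); field.
rewrite -(powR_inv1 (ltW d0)) -!powRrM; congr (_ `^ _).
by field.
Qed.

(** Hoelder's inequality for the vectors (C, mu_(n+1)^(1-p)) and (x^p, y^p);
    the recursion evaluates the first norm to n^(-p) + mu_n^(1-p). *)
Lemma copson_step (R : realType) (p x y : R) (n : nat) :
  0 < p < 1 -> (1 <= n)%N -> 0 <= mu p n.+1 -> 0 <= x -> 0 <= y ->
  (p / (1 - p)) `^ p * x `^ p + mu p n.+1 `^ (1 - p) * y `^ p <=
  (n%:R `^ (- p) + mu p n `^ (1 - p)) * (x + y) `^ p.
Proof.
move=> hp n1 mS0 x0 y0; have /andP[p0 p1] := hp.
have q0 : 0 < 1 - p by rewrite subr_gt0.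
rewrite -(copson_constant_powR _ _ hp).
have := muS R p n n1; set K := _ `^ (p / (p - 1)).
have : 0 <= K := powR_ge0 _ _; move: K => K K0 muE.
have {}muE : K + mu p n.+1 = (n%:R `^ (- p) + mu p n `^ (1 - p)) `^ (1 - p)^-1.
  by rewrite muE addrC subrK mul1r.
have := @hoelder2 R (K `^ (1 - p)) (mu p n.+1 `^ (1 - p)) (x `^ p) (y `^ p)
  (1 - p)^-1 p^-1.
rewrite !powR_ge0 !invr_gt0 !invrK => /(_ isT isT isT isT q0 p0).
rewrite -!powRrM !divff ?gt_eqF// !powRr1 ?powR_ge0//.
rewrite muE -powRrM mulVf ?gt_eqF// powRr1 ?addr_ge0 ?powR_ge0//.
by apply; rewrite subrK.
Qed.

(** The term in [mu p n.+1] is what is left of the telescoping sum; at the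
    other end [mu p 1 = 0]. *)
Lemma copson_partial_sums (R : realType) (p : R) (x : nat -> R) (n : nat) :
  0 < p < 1 -> (forall m, (1 <= m)%N -> 0 <= mu p m) -> 
  (forall m, (1 <= m)%N -> 0 <= x m) ->
  (forall m, (1 <= m)%N -> summable_from m x) ->
  (p / (1 - p)) `^ p * psum 1 (fun k => x k `^ p) n.+1 +
    mu p n.+1 `^ (1 - p) * sum_from n.+1 x `^ p <=
  psum 1 (tail_mean_pow p x) n.+1.
Proof.
move=> hp mu0 x0 sx; have /andP[p0 p1] := hp.
have S0 m : (1 <= m)%N -> 0 <= sum_from m x.
  by move=> m1; apply: sum_from_ge0 (sx m m1) _ => k /(leq_trans m1)/x0.
elim: n => [|n IH].
  by rewrite /psum !big_geq//= powR0 ?mul0r ?mulr0 ?addr0// subr_eq0 gt_eqF.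
rewrite !(@psum_recr R _ 1 n.+1)// mulrDr.
have := copson_step R p (x n.+1) (sum_from n.+2 x) n.+1 hp isT
  (mu0 n.+2 isT) (x0 n.+1 isT) (S0 n.+2 isT).
rewrite -(sum_from_recl _ _ _ (sx n.+2 isT)) => step.
have -> := tail_mean_powE _ p _ _ (S0 n.+1 isT).
move: step IH; rewrite mulrDl; lra.
Qed.

Lemma copson_of_mu_ge0 (R : realType) (p : R) (x : nat -> R) :
  0 < p < 1 -> (forall m, (1 <= m)%N -> 0 <= mu p m) ->
  admissible p x -> copson_ineq p ((p / (1 - p)) `^ p) x.
Proof.
move=> hp mu0 [x0 sx sT sxp]; rewrite /copson_ineq /sum_from.
have cxp := psum_cvgZ _ _ _ ((p / (1 - p)) `^ p) _ sxp.
rewrite -(cvg_lim _ cxp)//; apply: ler_lim => //.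
  by apply/cvg_ex; eexists; exact: cxp.
have x0' k : (1 <= k)%N -> 0 <= x k by move=> /x0/ltW.
near=> N; have N0 : (0 < N)%N by near: N; exact: nbhs_infty_gt.
rewrite -(prednK N0).
apply: le_trans (copson_partial_sums _ _ _ N.-1 hp mu0 x0' sx).
by rewrite psumZ lerDl mulr_ge0// powR_ge0.
Unshelve. all: by end_near. Qed.

(** * Sharpness of the constant *)

(** The extremal sequence: its tail from n is exactly n^(-s). *)
Definition powN_diff (R : realType) (s : R) (n : nat) : R :=
  n%:R `^ (- s) - n.+1%:R `^ (- s).

(** Both bounds are tangent inequalities for t^(-s), one at n + 1 and one
    at n. *)
Lemma powN_diff_bounds (R : realType) (s : R) (n : nat) :
  0 < s -> (1 <= n)%N ->
  s * n.+1%:R `^ (- s - 1) <= powN_diff R s n <= s * n%:R `^ (- s - 1).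
Proof.
move=> s0 n1; have n0 : 0 < n%:R :> R by rewrite ltr0n.
have n0' : 0 < n.+1%:R :> R by rewrite ltr0n.
have nn : n.+1%:R = n%:R + 1 :> R by rewrite -natr1.
have := powRN_tangent R s _ _ s0 n0 n0'.
have := powRN_tangent R s _ _ s0 n0' n0.
rewrite /powN_diff; set u := n%:R `^ (- s - 1); set v := n.+1%:R `^ (- s - 1).
have -> : n%:R - n.+1%:R = -1 :> R by rewrite nn; lra.
have -> : n.+1%:R - n%:R = 1 :> R by rewrite nn; lra.
lra.
Qed.

Lemma powN_cvg0 (R : realType) (s : R) : 0 < s ->
  (n%:R `^ (- s) : R) @[n --> \oo] --> (0 : R).
Proof.
move=> s0.
have h : ((n%:R : R)^-1) @[n --> \oo] --> (0 : R)^'+.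
  have h0 : ((n%:R : R)^-1) @[n --> \oo] --> (0 : R).
    apply/gtr0_cvgV0; last exact: cvgr_idn.
    by near=> n; rewrite ltr0n; near: n; exact: nbhs_infty_gt.
  move=> A /h0 /=; apply: filterS2 (nbhs_infty_gt 0) => n n0; apply.
  by rewrite /= invr_gt0 ltr0n.
apply: cvg_trans (cvg_comp _ _ h (powR_cvg0 s0)).
apply: near_eq_cvg; near=> n => /=.
by rewrite -(powR_inv1 (ler0n R n)) -powRrM mulN1r.
Unshelve. all: by end_near. Qed.

Lemma psum_powN_diff (R : realType) (s : R) (m n : nat) : (m <= n)%N ->
  psum m (powN_diff R s) n = m%:R `^ (- s) - n%:R `^ (- s).
Proof.
move=> mn; rewrite /psum -opprB -(telescope_sumr (fun k => k%:R `^ (- s)) mn).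
by rewrite -sumrN; apply: eq_bigr => k _; rewrite opprB.
Qed.

Lemma psum_powN_diff_cvg (R : realType) (s : R) (m : nat) : 0 < s ->
  psum m (powN_diff R s) n @[n --> \oo] --> m%:R `^ (- s).
Proof.
move=> s0.
have cm : (m%:R `^ (- s) : R) @[_ --> \oo] --> m%:R `^ (- s) by exact: cvg_cst.
have := cvgB cm (powN_cvg0 R s s0).
rewrite subr0 => /(_ _) cvgm; apply: cvg_trans cvgm.
apply: near_eq_cvg; near=> n.
by rewrite psum_powN_diff//; near: n; exact: nbhs_infty_ge.
Unshelve. all: by end_near. Qed.

Lemma pseries_summable (R : realType) (d : R) : 0 < d ->
  summable_from 1 (fun n => n%:R `^ (- d - 1) : R).
Proof.
move=> d0; apply/cvg_ex; eexists; apply: psum_recl_cvg.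
apply/cvg_ex; eexists; apply: psum_shift_cvg.
apply: (@summable_from_le _ _ _ (fun n => d^-1 * powN_diff R d n)); last first.
  by apply: summable_fromZ; apply/cvg_ex; eexists; exact: psum_powN_diff_cvg.
move=> n n1; rewrite powR_ge0/= ler_pdivlMl//.
by have /andP[] := powN_diff_bounds _ _ _ d0 n1.
Qed.

(** Comparison with the telescoping series of n^(-d) - (n+1)^(-d), whose
    terms are at most d n^(-d-1) and whose sum is 1. *)
Lemma pseries_ge (R : realType) (d : R) : 0 < d ->
  d^-1 <= sum_from 1 (fun n => n%:R `^ (- d - 1) : R).
Proof.
move=> d0; have cd := @psum_powN_diff_cvg R d 1 d0.
have sd : summable_from 1 (powN_diff R d) by apply/cvg_ex; eexists; exact: cd.
have sumd : sum_from 1 (powN_diff R d) = 1.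
  by rewrite [LHS](cvg_lim _ cd)// powR1.
have -> : d^-1 = sum_from 1 (fun n => d^-1 * powN_diff R d n).
  by rewrite sum_fromZ// sumd mulr1.
apply: sum_from_le.
- move=> n n1; rewrite ler_pdivrMl//.
  by have /andP[] := powN_diff_bounds _ _ _ d0 n1.
- exact: summable_fromZ.
- exact: pseries_summable.
Qed.

Lemma copson_fails_above (R : realType) (p C : R) :
  0 < p < 1 -> (p / (1 - p)) `^ p < C ->
  exists x : nat -> R, admissible p x /\ ~ copson_ineq p C x.
Proof.
move=> /andP[p0 p1] hC; set C0 := (p / (1 - p)) `^ p in hC.
have q0 : 0 < 1 - p by rewrite subr_gt0.
have C00 : 0 < C0 by rewrite powR_gt0// divr_gt0.
(* The choice of d makes r (Z - 1) > Z follow from Z >= 1 / d. *)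
pose r := C / C0; have r1 : 1 < r by rewrite /r ltr_pdivlMr// mul1r.
have r0 : 0 < r by lra.
pose d := (r - 1) / (2 * r).
have d0 : 0 < d by apply: divr_gt0; lra.
pose s := (1 - p + d) / p.
have s0 : 0 < s by apply: divr_gt0; lra.
have sp : s * p = 1 - p + d by rewrite /s mulfVK// gt_eqF.
pose x := powN_diff R s; pose z n : R := n%:R `^ (- d - 1).
have sumx n : (1 <= n)%N -> psum n x @ \oo --> n%:R `^ (- s).
  by move=> _; exact: psum_powN_diff_cvg.
have sumxE n : (1 <= n)%N -> sum_from n x = n%:R `^ (- s).
  by move=> n1; apply/cvg_lim => //; exact: sumx.
have zE n : (n%:R `^ (- s - 1)) `^ p = z n.
  by rewrite -powRrM; congr (_ `^ _); rewrite mulrDl mulNr sp; ring.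
have x0 n : (1 <= n)%N -> 0 < x n.
  move=> n1; have /andP[h _] := powN_diff_bounds _ _ _ s0 n1.
  by apply: lt_le_trans h; rewrite mulr_gt0// powR_gt0 ltr0n.
have TE n : (1 <= n)%N -> tail_mean_pow p x n = z n.
  move=> n1; rewrite tail_mean_powE ?sumxE ?powR_ge0// -powRrM -powRD.
    by congr (_ `^ _); rewrite mulNr sp; ring.
  by rewrite pnatr_eq0 -lt0n n1 implybT.
have sz : summable_from 1 z by exact: pseries_summable.
have xp n : (1 <= n)%N -> s `^ p * z n.+1 <= x n `^ p <= s `^ p * z n.
  move=> n1; have /andP[h1 h2] := powN_diff_bounds _ _ _ s0 n1.
  have szE m : s `^ p * z m = (s * m%:R `^ (- s - 1)) `^ p.
    by rewrite -zE -(powRM _ (ltW s0) (powR_ge0 _ _)).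
  have nneg m : s * m%:R `^ (- s - 1) \in Num.nneg.
    by rewrite nnegrE (mulr_ge0 (ltW s0) (powR_ge0 _ _)).
  have xnneg : x n \in Num.nneg by rewrite nnegrE (ltW (x0 n n1)).
  rewrite !szE (ge0_ler_powR (ltW p0) (nneg _) xnneg h1).
  exact: (ge0_ler_powR (ltW p0) xnneg (nneg _) h2).
have sxp : summable_from 1 (fun n => x n `^ p).
  apply: (@summable_from_le _ _ _ (fun n => s `^ p * z n)).
    by move=> n n1; rewrite powR_ge0; have /andP[] := xp n n1.
  exact: summable_fromZ.
have psumT : psum 1 (tail_mean_pow p x) = psum 1 z.
  apply/funext => n; rewrite /psum big_nat_cond [RHS]big_nat_cond.
  by apply: eq_bigr => k /andP[/andP[k1 _] _]; exact: TE.
exists x; split.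
  split; [exact: x0| |by rewrite /summable_from psumT|exact: sxp].
  by move=> n n1; apply/cvg_ex; exists (n%:R `^ (- s)); exact: sumx.
rewrite /copson_ineq /sum_from psumT -/(sum_from 1 z).
have szS : summable_from 1 (fun n => z n.+1).
  apply: (@summable_from_le _ _ _ z) => // n n1; rewrite powR_ge0/=.
  rewrite /z -opprD !powRN lef_pV2 ?posrE ?powR_gt0 ?ltr0n//.
  by apply: ge0_ler_powR; rewrite ?nnegrE ?ler0n ?ler_nat//; lra.
have Zrec : sum_from 1 z = 1 + sum_from 1 (fun n => z n.+1).
  have sz2 : summable_from 2 z.
    apply/cvg_ex; exists (sum_from 1 (fun n => z n.+1)).
    exact: psum_shift_cvg _ _ _ szS.
  by rewrite (sum_from_recl _ _ _ sz2) (sum_from_shift _ _ _ szS) {1}/z powR1.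
have Xge : s `^ p * (sum_from 1 z - 1) <= limn (psum 1 (fun n => x n `^ p)).
  rewrite Zrec addrAC subrr add0r -sum_fromZ//; apply: sum_from_le => //.
    by move=> n n1; have /andP[] := xp n n1.
  exact: summable_fromZ.
have Zge : d^-1 <= sum_from 1 z by exact: pseries_ge.
have sC : 1 <= C0 * s `^ p.
  have g0 : 0 <= p / (1 - p) by rewrite divr_ge0 ?ltW.
  have gsE : p / (1 - p) * s = 1 + d / (1 - p).
    by rewrite /s; field; rewrite !gt_eqF.
  have gs1 : 1 <= p / (1 - p) * s by rewrite gsE lerDl divr_ge0// ltW.
  rewrite /C0 -(powRM _ g0 (ltW s0)) -[leLHS](powRr0 (p / (1 - p) * s)).
  by rewrite ler_powR ?(ltW p0).
have CE : C = r * C0 by rewrite /r divfK ?gt_eqF.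
move: Xge Zge; set Z := sum_from 1 z; set X := limn _ => Xge Zge.
apply/negP; rewrite -ltNge.
have dE : d^-1 = 2 * r / (r - 1) by rewrite /d invf_div.
have Zbig : 2 * r <= Z * (r - 1).
  by rewrite -ler_pdivrMr ?subr_gt0// -dE.
have Z1 : 0 <= Z - 1 by nra.
have h1 : r * (Z - 1) <= C * X.
  apply: (@le_trans _ _ (C * (s `^ p * (Z - 1)))).
    rewrite CE; have := ler_wpM2l (mulr_ge0 (ltW r0) Z1) sC; lra.
  by rewrite ler_wpM2l// CE mulr_ge0 ?ltW.
by apply: lt_le_trans h1; lra.
Qed.

Theorem theorem1p12 (R : realType) (p : R) (hp : 1 / 3 <= p < 1)
  (hyp : exists (n0 : nat) (c : R),
     (1 <= n0)%N /\ mu_defined p n0 /\ 0 <= 1 + c / n0%:R /\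
     mu p n0 >= (1 / p - 1) `^ (1 / (p - 1)) * (n0%:R + c) /\
     c > - (1 / (2 * p)) /\
     (1 / p - 1) * (1 / n0%:R) + (1 + c * (1 / n0%:R)) `^ (1 - p)
       - (1 + (c + 1 / p) * (1 / n0%:R)) `^ (1 - p) >= 0) :
  (forall x : nat -> R, admissible p x ->
     copson_ineq p ((p / (1 - p)) `^ p) x) /\
  (forall C : R, (p / (1 - p)) `^ p < C ->
     exists x : nat -> R, admissible p x /\ ~ copson_ineq p C x).
Proof.
have /andP[p13 p1] := hp.
have p0 : 0 < p by apply: lt_le_trans p13; rewrite divr_gt0.
have p01 : 0 < p < 1 by rewrite p0.
split; last by move=> C; exact: copson_fails_above.
have [n0 [c [n01 [mudef [c1 [hmu [hc gap]]]]]]] := hyp.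
move=> x; apply: copson_of_mu_ge0 => //.
apply: (mu_ge0 _ _ c n0) => //; rewrite -subr_ge0.
apply: le_trans gap _; rewrite le_eqVlt; apply/orP; left; apply/eqP.
have n0ne : n0%:R != 0 :> R by rewrite pnatr_eq0 -lt0n.
have pne : p != 0 by rewrite gt_eqF.
rewrite /tangent_gap !div1r; field.
by rewrite pne n0ne.
Qed.
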